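(* Let $A\in\mathbb{R}^{m\times p}$, $B\in\mathbb{R}^{q\times n}$ and $C\in\mathbb{R}^{m\times n}$ be such that the matrix equation $AXB=C$ has a solution $X\in\mathbb{R}^{p\times q}$. Let $X_*=A^\dagger CB^\dagger$ be its minimal Frobenius norm solution, and let $X_k$ be the $k$th approximation of $X_*$ generated by the global randomized average block Kaczmarz (GRABK) method with adaptive stepsize described in the context, started from a given $X_0\in\mathbb{R}^{p\times q}$, with weights satisfying $0<u_{\min}\le u_i^{k}\le u_{\max}<1$ for all $i\in[m]$ and $0<v_{\min}\le v_j^{k}\le v_{\max}<1$ for all $j\in[n]$ (for all $k\ge0$), and with stepsize $\alpha_k=\eta L_k$ for some $\eta\in(0,2)$, where $L_k$ is defined in the context. Then the expected norm of the error at the $k$th iteration satisfies $$\mathbb{E}\|X_k-X_*\|_F^2\le\left(1-\eta(2-\eta)\,\psi\,\sigma_{\min}^2(D_A)\,\sigma_{\min}^2(D_B)\,\sigma_{\min}^2(A)\,\sigma_{\min}^2(B)\right)^k\|X_0-X_*\|_F^2,$$ where $$\psi=\frac{u_{\min}v_{\min}}{u_{\max}v_{\max}\,\gamma_{\max}^2(A)\,\gamma_{\max}^2(B)}$$ and $\gamma_{\max}(A),\gamma_{\max}(B)$ and the block diagonal matrices $D_A,D_B$ are defined in the context.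
   Context: Notation: $[m]=\{1,\dots,m\}$; $\|\cdot\|$ is the Euclidean norm of a row or column vector; $\|\cdot\|_F$ is the Frobenius norm; $M^\dagger$ is the Moore–Penrose pseudoinverse; $\sigma_{\max}(M)$ is the largest singular value and $\sigma_{\min}(M)$ the smallest nonzero singular value of $M$. $A_{i,:}$ is the $i$th row of $A$, $B_{:,j}$ the $j$th column of $B$, $C_{ij}$ the $(i,j)$ entry of $C$; for $I\subseteq[m]$, $J\subseteq[n]$, $A_{I,:}$ is the row submatrix of $A$ indexed by $I$ and $B_{:,J}$ the column submatrix of $B$ indexed by $J$. The rows of $A$ and the columns of $B$ are nonzero, so that the expressions below are defined. Sampling: the index sets $I\subseteq[m]$ that may be selected have probabilities $\mathbb{P}(I)>0$ with $\sum_I\mathbb{P}(I)=1$; the index sets $J\subseteq[n]$ that may be selected have probabilities $\mathbb{P}(J)>0$ with $\sum_J\mathbb{P}(J)=1$. Weights: for each $k\ge0$, real numbers $u_i^k$ and $v_j^k$ with $\sum_{i\in I_k}u_i^k=1$ and $\sum_{j\in J_k}v_j^k=1$ for the index sets $I_k,J_k$ selected at iteration $k$; the superscript $k$ is an index, not a power. Put $\hat u_i^k=u_i^k/\|A_{i,:}\|^2$ and $\hat v_j^k=v_j^k/\|B_{:,j}\|^2$. GRABK method with adaptive stepsize: given $X_0\in\mathbb{R}^{p\times q}$, at each iteration $k=0,1,2,\dots$ select an index set $I_k\subseteq[m]$ with probability $\mathbb{P}(I_k)$ and an index set $J_k\subseteq[n]$ with probability $\mathbb{P}(J_k)$, independently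 of each other and of all previous selections, and set $$X_{k+1}=X_k+\alpha_k\sum_{i\in I_k,\,j\in J_k}\hat u_i^k\hat v_j^k\,A_{i,:}^T(C_{ij}-A_{i,:}X_kB_{:,j})B_{:,j}^T,\qquad \alpha_k=\eta L_k,$$ where $$L_k=\frac{\sum_{i\in I_k,\,j\in J_k}\hat u_i^k\hat v_j^k\,(C_{ij}-A_{i,:}X_kB_{:,j})^2}{\left\|\sum_{i\in I_k,\,j\in J_k}\hat u_i^k\hat v_j^k\,A_{i,:}^T(C_{ij}-A_{i,:}X_kB_{:,j})B_{:,j}^T\right\|_F^2}.$$ (If the denominator of $L_k$ is zero, the update direction is zero and $X_{k+1}=X_k$.) For index sets $I$, $J$ that may be selected let $D_I=\mathrm{diag}(\|A_{i,:}\|^{-1},\,i\in I)$ and $D_J=\mathrm{diag}(\|B_{:,j}\|^{-1},\,j\in J)$, and put $$\gamma_{\max}(A)=\max_{I}\sigma_{\max}(D_IA_{I,:}),\qquad \gamma_{\max}(B)=\max_{J}\sigma_{\max}(B_{:,J}D_J),$$ the maxima being over the index sets that may be selected. $D_A$ is the block diagonal matrix with diagonal blocks $\mathbb{P}(I)^{\frac12}D_I$, one for each such $I\subseteq[m]$; $D_B$ is the block diagonal matrix with diagonal blocks $\mathbb{P}(J)^{\frac12}D_J$, one for each such $J\subseteq[n]$.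
   Formalization: Two assumptions are added, without which the claim is false: X_0 has the form A^T Y B^T for some Y (a component outside this space is never reduced), and every row index and column index belongs to some index set that may be selected. *)

(* Defs.v *)
From HB Require Import structures.
From mathcomp Require Import all_boot all_order all_algebra.
From mathcomp Require Import all_classical all_reals all_analysis.
Set Implicit Arguments.
Unset Strict Implicit.
Unset Printing Implicit Defensive.
Import Order.TTheory GRing.Theory Num.Theory.
Local Open Scope classical_set_scope.
Local Open Scope ring_scope.

(* On a row or a column vector this is the Euclidean norm.  MathComp-Analysis's
   own norm `|M| on matrices is the sup norm. *)
Definition fnorm (R : realType) (m n : nat) (M : 'M[R]_(m, n)) : R :=
  Num.sqrt (\sum_i \sum_j M i j ^+ 2).

Definition moore_penrose (R : realType) (m n : nat)
    (M : 'M[R]_(m, n)) (G : 'M[R]_(n, m)) : Prop :=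
  [/\ M *m G *m M = M, G *m M *m G = G,
      (M *m G)^T = M *m G & (G *m M)^T = G *m M].

Definition pseudoinverse (R : realType) (m n : nat)
    (M : 'M[R]_(m, n)) : 'M[R]_(n, m) :=
  xget 0 [set G | moore_penrose M G].

Lemma mulmxT_eq0 (R : realType) (m n : nat) (M : 'M[R]_(m, n)) :
  M *m M^T = 0 -> M = 0.
Proof.
move=> M0; apply/matrixP => i j; rewrite mxE.
have : \sum_k M i k ^+ 2 = 0.
  have /matrixP/(_ i i) := M0; rewrite !mxE; apply: etrans.
  by apply: eq_bigr => k _; rewrite mxE expr2.
move/eqP; rewrite psumr_eq0 => [/allP/(_ j)|k _]; last exact: sqr_ge0.
by rewrite mem_index_enum /= sqrf_eq0 => /(_ isT)/eqP.
Qed.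

Lemma row_free_gram (R : realType) (m n : nat) (M : 'M[R]_(m, n)) :
  row_free M -> M *m M^T \in unitmx.
Proof.
move=> Mfree; rewrite -row_free_unit -kermx_eq0; apply/eqP.
set K := kermx _; have K0 : K *m (M *m M^T) = 0 by exact: mulmx_ker.
apply: (row_free_inj Mfree); rewrite mul0mx; apply: mulmxT_eq0.
by rewrite trmx_mul !mulmxA -(mulmxA K) K0 mul0mx.
Qed.

Lemma pseudoinverseP (R : realType) (m n : nat) (M : 'M[R]_(m, n)) :
  moore_penrose M (pseudoinverse M).
Proof.
suff [G MG] : exists G, moore_penrose M G by exact: (xgetPex 0 (ex_intro _ G MG)).
have [r [L [S [ML Lf Sf]]]] : exists r (L : 'M[R]_(m, r)) (S : 'M[R]_(r, n)),
    [/\ L *m S = M, row_free L^T & row_free S].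
  exists (\rank M), (col_base M), (row_base M); split=> //.
  - exact: mulmx_base.
  - by rewrite /row_free mxrank_tr; exact: col_base_full.
  - exact: row_base_free.
pose U := S *m S^T; pose V := L^T *m L.
have Uu : U \in unitmx by exact: row_free_gram.
have Vu : V \in unitmx by rewrite /V -{2}(trmxK L); exact: row_free_gram.
have UT : (invmx U)^T = invmx U by rewrite trmx_inv /U trmx_mul trmxK.
have VT : (invmx V)^T = invmx V by rewrite trmx_inv /V trmx_mul trmxK.
pose G := S^T *m invmx U *m invmx V *m L^T.
have MG : M *m G = L *m invmx V *m L^T.
  rewrite -ML /G !mulmxA -(mulmxA L S) -/U -(mulmxA L U) mulmxV //.
  by rewrite mulmx1.
have GM : G *m M = S^T *m invmx U *m S.
  rewrite -ML /G !mulmxA -(mulmxA _ L^T L) -/V -(mulmxA _ (invmx V) V).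
  by rewrite mulVmx // mulmx1.
exists G; split.
- rewrite MG -ML !mulmxA -(mulmxA _ L^T L) -/V -(mulmxA L) mulVmx //.
  by rewrite mulmx1.
- rewrite GM /G !mulmxA -(mulmxA _ S S^T) -/U -(mulmxA S^T (invmx U) U).
  by rewrite mulVmx // mulmx1.
- by rewrite MG !trmx_mul trmxK VT mulmxA.
- by rewrite GM !trmx_mul trmxK UT mulmxA.
Qed.

Lemma moore_penrose_unique (R : realType) (m n : nat) (M : 'M[R]_(m, n))
    (G H : 'M[R]_(n, m)) : moore_penrose M G -> moore_penrose M H -> G = H.
Proof.
move=> [G1 G2 G3 G4] [H1 H2 H3 H4].
have MGH : M *m G = M *m H.
  rewrite -G3 -{1}H1 -mulmxA trmx_mul G3 H3.
  by rewrite mulmxA G1.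
have GHM : G *m M = H *m M.
  rewrite -G4 -{1}H1 -mulmxA mulmxA trmx_mul G4 H4.
  by rewrite -mulmxA (mulmxA M) G1.
by rewrite -G2 -mulmxA MGH mulmxA GHM H2.
Qed.

(* The spectrum of M^T M agrees with the set of squared singular values of M
   except possibly for the eigenvalue 0, which affects neither the largest nor
   the smallest nonzero singular value. *)
Definition singular_value (R : realType) (m n : nat) (M : 'M[R]_(m, n))
    (s : R) : Prop :=
  0 <= s /\ eigenvalue (M^T *m M) (s ^+ 2).

(* The sets below are finite, so sup and inf are a maximum and a minimum
   as soon as the set is nonempty. *)
Definition sigma_max (R : realType) (m n : nat) (M : 'M[R]_(m, n)) : R :=
  sup [set s | singular_value M s].

Definition sigma_min (R : realType) (m n : nat) (M : 'M[R]_(m, n)) : R :=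
  inf [set s | singular_value M s /\ s != 0].

Section Blocks.
Variables (R : realType) (m p : nat).

Definition row_block (A : 'M[R]_(m, p)) (I : {set 'I_m}) : 'M[R]_(#|I|, p) :=
  rowsub enum_val A.

Definition col_block (B : 'M[R]_(p, m)) (J : {set 'I_m}) : 'M[R]_(p, #|J|) :=
  colsub enum_val B.

Definition row_scaling (A : 'M[R]_(m, p)) (I : {set 'I_m}) : 'M[R]_#|I| :=
  diag_mx (\row_r (fnorm (row (enum_val r) A))^-1).

Definition col_scaling (B : 'M[R]_(p, m)) (J : {set 'I_m}) : 'M[R]_#|J| :=
  diag_mx (\row_r (fnorm (col (enum_val r) B))^-1).

(* pr gives the sampling probabilities, extended by 0 to the index sets that
   are never selected. *)
Definition selectable (pr : {set 'I_m} -> R) : {set {set 'I_m}} :=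
  finset (fun I => 0 < pr I).

Definition sampling (pr : {set 'I_m} -> R) : Prop :=
  (forall I, 0 <= pr I) /\ \sum_I pr I = 1.

Definition row_gamma_max (A : 'M[R]_(m, p)) (pr : {set 'I_m} -> R) : R :=
  \big[Num.max/0]_(I in selectable pr)
    sigma_max (row_scaling A I *m row_block A I).

Definition col_gamma_max (B : 'M[R]_(p, m)) (pr : {set 'I_m} -> R) : R :=
  \big[Num.max/0]_(J in selectable pr)
    sigma_max (col_block B J *m col_scaling B J).

Definition row_D (A : 'M[R]_(m, p)) (pr : {set 'I_m} -> R) :=
  \mxdiag_(k < #|selectable pr|)
    (Num.sqrt (pr (enum_val k)) *: row_scaling A (enum_val k)).

Definition col_D (B : 'M[R]_(p, m)) (pr : {set 'I_m} -> R) :=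
  \mxdiag_(k < #|selectable pr|)
    (Num.sqrt (pr (enum_val k)) *: col_scaling B (enum_val k)).

End Blocks.

Section Iteration.
Variables (R : realType) (m p q n : nat).
Variables (A : 'M[R]_(m, p)) (B : 'M[R]_(q, n)) (C : 'M[R]_(m, n)).

Definition residual (X : 'M[R]_(p, q)) (i : 'I_m) (j : 'I_n) : R :=
  C i j - (row i A *m X *m col j B) 0 0.

Definition weight (u : 'I_m -> R) (v : 'I_n -> R) (i : 'I_m) (j : 'I_n) : R :=
  (u i / fnorm (row i A) ^+ 2) * (v j / fnorm (col j B) ^+ 2).

Definition direction (u : 'I_m -> R) (v : 'I_n -> R)
    (I : {set 'I_m}) (J : {set 'I_n}) (X : 'M[R]_(p, q)) : 'M[R]_(p, q) :=
  \sum_(i in I) \sum_(j in J)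
    (weight u v i j * residual X i j) *: ((row i A)^T *m (col j B)^T).

(* When the direction vanishes, division by 0 yields the value 0; the iterate
   is then unchanged whatever the stepsize. *)
Definition adaptive_step (u : 'I_m -> R) (v : 'I_n -> R)
    (I : {set 'I_m}) (J : {set 'I_n}) (X : 'M[R]_(p, q)) : R :=
  (\sum_(i in I) \sum_(j in J) weight u v i j * residual X i j ^+ 2)
    / fnorm (direction u v I J X) ^+ 2.

Fixpoint grabk (eta : R) (u : nat -> 'I_m -> R) (v : nat -> 'I_n -> R)
    (I : nat -> {set 'I_m}) (J : nat -> {set 'I_n}) (X0 : 'M[R]_(p, q))
    (k : nat) : 'M[R]_(p, q) :=
  if k is l.+1 then
    let X := grabk eta u v I J X0 l in
    X + (eta * adaptive_step (u l) (v l) (I l) (J l) X)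
          *: direction (u l) (v l) (I l) (J l) X
  else X0.

End Iteration.

Definition mutually_independent (R : realType) (d : measure_display)
    (T : measurableType d) (P : probability T R) (K : choiceType)
    (G : K -> set (set T)) : Prop :=
  forall (s : seq K) (E : K -> set T), uniq s ->
    (forall t, t \in s -> G t (E t)) ->
    P (\bigcap_(t in [set` s]) E t) = (\prod_(t <- s) P (E t))%E.

(* The sigma-algebra generated by a variable with values in a finite
   (discrete) type. *)
Definition generated_events (T : Type) (F : finType) (X : T -> F) :
  set (set T) := preimage_set_system setT X setT.

Definition has_law (R : realType) (d : measure_display) (T : measurableType d)
    (P : probability T R) (F : finType) (X : T -> F) (pr : F -> R) : Prop :=
  forall a, measurable (X @^-1` [set a]) /\ P (X @^-1` [set a]) = (pr a)%:E.

Definition selection_events (T : Type) (m n : nat)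
    (I : nat -> T -> {set 'I_m}) (J : nat -> T -> {set 'I_n})
    (t : nat + nat) : set (set T) :=
  match t with
  | inl k => generated_events (I k)
  | inr k => generated_events (J k)
  end.

(* A quantity chosen at iteration k may depend on all selections made up to and
   including iteration k, but not on later ones. *)
Definition nonanticipating (T V : Type) (m n : nat)
    (I : nat -> T -> {set 'I_m}) (J : nat -> T -> {set 'I_n})
    (u : nat -> T -> V) : Prop :=
  forall k w w', (forall l, (l <= k)%N -> I l w = I l w' /\ J l w = J l w') ->
    u k w = u k w'.

(* Main.v *)
Require Import Defs.
From HB Require Import structures.
From mathcomp Require Import all_boot all_order all_algebra.
From mathcomp Require Import all_classical all_reals all_analysis.
From mathcomp Require Import measurable_realfun.
From mathcomp Require Import ring lra.
Set Implicit Arguments.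
Unset Strict Implicit.
Unset Printing Implicit Defensive.
Import Order.TTheory GRing.Theory Num.Theory.
Local Open Scope classical_set_scope.
Local Open Scope ring_scope.

(* Write E = X_k - X_* and N = sum w_ij (A E B)_ij^2 over the selected blocks.
   The update direction D satisfies <E, D> = - N, so the adaptive step gives
   ||E'||^2 = ||E||^2 - eta (2 - eta) N^2 / ||D||^2.  Since D = F^T M G^T with
   F = D_I A_I, G = B_J D_J, one has ||D||^2 <= gamma(A)^2 gamma(B)^2 umax vmax N,
   whence N^2 / ||D||^2 >= psi * sum (A E B)_ij^2 / (||A_i||^2 ||B_j||^2).
   Each P(I) / ||A_i||^2 with i in I is a squared singular value of D_A (likewise
   for B), and every index is covered, so the mean of this sum over (I, J) is at
   least sigma_min(D_A)^2 sigma_min(D_B)^2 ||A E B||_F^2; finally E stays of the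
   form A^T Y B^T, on which ||A E B||_F >= sigma_min(A) sigma_min(B) ||E||_F.
   The iterate X_k is a function of the finitely many possible histories of
   selections, which are independent of the selection made at step k, so taking
   expectations amounts to finite sums. *)

(** * Frobenius norms and quadratic forms *)

Lemma fnorm_sqrE (R : realType) (m n : nat) (M : 'M[R]_(m, n)) :
  fnorm M ^+ 2 = \sum_i \sum_j M i j ^+ 2.
Proof.
by rewrite /fnorm sqr_sqrtr // sumr_ge0 // => i _; rewrite sumr_ge0 // => j _;
  exact: sqr_ge0.
Qed.

Lemma fnorm_sqr_tr (R : realType) (m n : nat) (M : 'M[R]_(m, n)) :
  fnorm M ^+ 2 = \tr (M *m M^T).
Proof.
rewrite fnorm_sqrE /mxtrace; apply: eq_bigr => i _; rewrite mxE.
by apply: eq_bigr => j _; rewrite mxE expr2.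
Qed.

Lemma fnorm_tr (R : realType) (m n : nat) (M : 'M[R]_(m, n)) :
  fnorm M^T = fnorm M.
Proof.
rewrite /fnorm exchange_big /=; congr Num.sqrt.
by apply: eq_bigr => i _; apply: eq_bigr => j _; rewrite mxE.
Qed.

Lemma fnorm_sqr_eq0 (R : realType) (m n : nat) (M : 'M[R]_(m, n)) :
  fnorm M ^+ 2 = 0 -> M = 0.
Proof.
move=> /eqP; rewrite fnorm_sqrE psumr_eq0 => [/allP h|i _]; last first.
  by rewrite sumr_ge0 // => j _; exact: sqr_ge0.
apply/matrixP => i j; rewrite mxE.
have := h i; rewrite mem_index_enum => /(_ isT) /=.
rewrite psumr_eq0 => [/allP/(_ j)|k _]; last exact: sqr_ge0.
by rewrite mem_index_enum sqrf_eq0 => /(_ isT)/eqP.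
Qed.

Lemma fnorm_sqr_gt0 (R : realType) (m n : nat) (M : 'M[R]_(m, n)) :
  M != 0 -> 0 < fnorm M ^+ 2.
Proof.
by move=> M0; rewrite lt_def sqr_ge0 andbT; apply: contra_neq M0 => /fnorm_sqr_eq0.
Qed.

Lemma fnorm_gt0 (R : realType) (m n : nat) (M : 'M[R]_(m, n)) :
  M != 0 -> 0 < fnorm M.
Proof.
move=> M0; rewrite lt_def sqrtr_ge0 andbT; apply: contra_neq M0 => f0.
by apply: fnorm_sqr_eq0; rewrite f0 expr0n.
Qed.

Lemma fnorm0 (R : realType) (m n : nat) : fnorm (0 : 'M[R]_(m, n)) = 0.
Proof.
by rewrite /fnorm big1 ?sqrtr0 // => i _; rewrite big1 // => j _; rewrite mxE expr0n.
Qed.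

Lemma fnorm_sqrD (R : realType) (m n : nat) (M N : 'M[R]_(m, n)) (t : R) :
  fnorm (M + t *: N) ^+ 2 =
  fnorm M ^+ 2 + 2 * t * \tr (M *m N^T) + t ^+ 2 * fnorm N ^+ 2.
Proof.
rewrite !fnorm_sqr_tr linearD /= linearZ /= mulmxDl !mulmxDr !linearD /=.
rewrite -!scalemxAl -!scalemxAr !linearZ /= -(mxtrace_tr (N *m M^T)).
by rewrite trmx_mul trmxK; ring.
Qed.

Lemma quad_form_bound (R : realType) (n : nat) (N : 'M[R]_n) :
  exists2 K : R, 0 < K & forall (r : nat) (X : 'M[R]_(r, n)),
    \tr (X *m N *m X^T) <= K * fnorm X ^+ 2.
Proof.
(* In each row x of [X], |x_i N_ij x_j| is at most |N_ij| times the squared norm of x. The constant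
   does not depend on the number [r] of rows. *)
pose K := \sum_i \sum_j `|N i j|.
have K0 : 0 <= K by rewrite sumr_ge0 // => i _; rewrite sumr_ge0.
exists (K + 1) => [|r X]; first by rewrite ltr_wpDl.
rewrite fnorm_sqrE mulr_sumr /mxtrace; apply: ler_sum => k _.
set s := \sum_j _.
have s0 : 0 <= s by rewrite sumr_ge0 // => j _; exact: sqr_ge0.
have le_s i : X k i ^+ 2 <= s.
  by rewrite /s (bigD1 i) //= lerDl sumr_ge0 // => j _; exact: sqr_ge0.
apply: (@le_trans _ _ (K * s)); last by rewrite ler_wpM2r // lerDl.
rewrite mxE /K exchange_big mulr_suml; apply: ler_sum => j _ /=.
rewrite !mxE !mulr_suml; apply: ler_sum => i _.
apply: le_trans (ler_norm _) _; rewrite !normrM mulrAC mulrC ler_wpM2l //.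
have := le_s i; have := le_s j; rewrite -(normr_id (X k i)).
rewrite -[X k i ^+ 2]real_normK ?num_real // -[X k j ^+ 2]real_normK ?num_real //.
rewrite normr_id; nra.
Qed.

(* Apply positivity to [X - t X N] with [t = 1 / K], [K] bounding the form. *)
Lemma unit_psd_coercive (R : realType) (r n : nat) (N : 'M[R]_n) :
  N^T = N -> N \in unitmx ->
  (forall X : 'M[R]_(r, n), 0 <= \tr (X *m N *m X^T)) ->
  exists2 c : R, 0 < c & forall X : 'M[R]_(r, n),
    c * fnorm X ^+ 2 <= \tr (X *m N *m X^T).
Proof.
move=> Nsym Nunit Npsd.
have [K K0 leK] := quad_form_bound N.
have [L L0 leL] := quad_form_bound (invmx N *m (invmx N)^T).
(* Two factors multiply: [fnorm X ^+ 2] is at most [L] times [fnorm (X *m N) ^+ 2], as [N] is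
   invertible, and the latter is at most [K] times the form. *)
exists (K * L)^-1 => [|X]; first by rewrite invr_gt0 mulr_gt0.
rewrite ler_pdivrMl ?mulr_gt0 //.
have XL : fnorm X ^+ 2 <= L * fnorm (X *m N) ^+ 2.
  rewrite {1}fnorm_sqr_tr; apply: le_trans (leL _ _).
  rewrite [(X *m N)^T]trmx_mul !mulmxA mulmxK // -(mulmxA X) -trmx_mul.
  by rewrite mulmxV // trmx1 mulmx1.
apply: le_trans XL _; rewrite mulrAC [leRHS]mulrC ler_pM2l // mulrC.
set Y := X *m N; have := Npsd (X + (- K^-1) *: Y); have := leK _ Y.
set q := \tr (Y *m N *m Y^T).
have -> : \tr ((X + - K^-1 *: Y) *m N *m (X + - K^-1 *: Y)^T) =
   \tr (Y *m X^T) - 2 * K^-1 * fnorm Y ^+ 2 + K^-1 ^+ 2 * q.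
  rewrite linearD /= linearZ /= !mulmxDl !mulmxDr !linearD /= -/Y.
  rewrite -!scalemxAr -?scalemxAl -?scalemxAr !mxtraceZ -/q.
  have -> : \tr (Y *m N *m X^T) = fnorm Y ^+ 2.
    by rewrite fnorm_sqr_tr [in RHS]trmx_mul Nsym mulmxA.
  by rewrite -fnorm_sqr_tr; ring.
move=> qK h.
have : K^-1 ^+ 2 * q <= K^-1 * fnorm Y ^+ 2.
  rewrite expr2 -mulrA ler_pM2l ?invr_gt0 // mulrC ler_pdivrMr // mulrC //.
have h1 : K * K^-1 = 1 by rewrite divff // gt_eqF.
move=> h2; have h3 : K^-1 * fnorm Y ^+ 2 <= \tr (Y *m X^T) by lra.
by rewrite mulrC -ler_pdivrMl.
Qed.

Lemma not_unit_kernel (R : fieldType) (n : nat) (N : 'M[R]_n) :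
  N \notin unitmx -> exists2 x : 'rV[R]_n, x != 0 & x *m N = 0.
Proof.
rewrite -row_free_unit -kermx_eq0 => /rowV0Pn [x xk x0].
by exists x => //; apply/sub_kermxP.
Qed.

(** * Extremal singular values *)

Lemma tr_gram (R : realType) (r m n : nat) (M : 'M[R]_(m, n)) (X : 'M[R]_(r, n)) :
  \tr (X *m (M^T *m M) *m X^T) = fnorm (X *m M^T) ^+ 2.
Proof. by rewrite fnorm_sqr_tr trmx_mul trmxK !mulmxA. Qed.

Lemma gram_tr (R : realType) (m n : nat) (M : 'M[R]_(m, n)) :
  (M^T *m M)^T = M^T *m M.
Proof. by rewrite trmx_mul trmxK. Qed.

Lemma singular_value_ubound (R : realType) (m n : nat) (M : 'M[R]_(m, n)) :
  has_ubound [set s | singular_value M s].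
Proof.
have [K K0 leK] := quad_form_bound (M^T *m M).
(* An eigenvector gives [s ^+ 2 <= K], and then [s <= K + 1] without taking roots. *)
exists (K + 1) => s [s0 /eigenvalueP [x xs x0]].
have := leK _ x; rewrite xs -scalemxAl mxtraceZ -fnorm_sqr_tr.
by rewrite ler_pM2r ?fnorm_sqr_gt0 //; nra.
Qed.

Lemma sigma_max_ge0 (R : realType) (m n : nat) (M : 'M[R]_(m, n)) :
  0 <= sigma_max M.
Proof.
rewrite /sigma_max.
have [->|/set0P [s Ms]] := eqVneq [set s | singular_value M s] set0.
  by rewrite sup0.
by apply: le_trans (ub_le_sup (singular_value_ubound M) Ms); case: Ms.
Qed.

Lemma sigma_min_ge0 (R : realType) (m n : nat) (M : 'M[R]_(m, n)) :
  0 <= sigma_min M.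
Proof.
rewrite /sigma_min; set S := [set s | _].
(* The set is empty for [M = 0]; [inf] is then 0 by convention. *)
have [->|/set0P S0] := eqVneq S set0; first by rewrite inf0.
by apply: lb_le_inf => // s [[]].
Qed.

Lemma sigma_min_le (R : realType) (m n : nat) (M : 'M[R]_(m, n)) (s : R) :
  singular_value M s -> s != 0 -> sigma_min M <= s.
Proof. by move=> Ms s0; apply: ge_inf => //; exists 0 => t [[]]. Qed.

(* The least [l] bounding the Rayleigh quotient of the Gram matrix [G] is an
   eigenvalue: otherwise [l I - G] is coercive and [l] could be decreased. *)
Lemma fnorm_mulmx_tr_le (R : realType) (r m n : nat)
    (M : 'M[R]_(m, n)) (X : 'M[R]_(r, n)) :
  fnorm (X *m M^T) ^+ 2 <= sigma_max M ^+ 2 * fnorm X ^+ 2.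
Proof.
(* A nonzero [X] makes the set [L] below bounded from below; tested on the zero matrix alone, every
   real would belong to it. *)
have [->|X0] := eqVneq X 0; first by rewrite mul0mx !fnorm0 expr0n mulr0.
pose G := M^T *m M.
pose L := [set l : R | forall Y : 'M[R]_(r, n),
  \tr (Y *m G *m Y^T) <= l * fnorm Y ^+ 2].
have L0 : lbound L 0.
  move=> l /(_ X); rewrite tr_gram => /(le_trans (sqr_ge0 _)).
  by rewrite pmulr_lge0 // fnorm_sqr_gt0.
have Lne : L !=set0 by have [K _ leK] := quad_form_bound G; exists K => Y.
pose l := inf L.
have l0 : 0 <= l by exact: lb_le_inf.
have Ll : L l.
  move=> Y; have [->|Y0] := eqVneq Y 0.
    by rewrite !mul0mx fnorm0 expr0n mulr0 mxtrace0.
  rewrite -ler_pdivrMr ?fnorm_sqr_gt0 //; apply: lb_le_inf => // t /(_ Y) tY.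
  by rewrite ler_pdivrMr ?fnorm_sqr_gt0.
have formE (Y : 'M[R]_(r, n)) : \tr (Y *m (l%:M - G) *m Y^T) =
    l * fnorm Y ^+ 2 - \tr (Y *m G *m Y^T).
  by rewrite mulmxBr mulmxBl linearB /= mul_mx_scalar -scalemxAl mxtraceZ
    -fnorm_sqr_tr.
have Gl : eigenvalue G l.
  have [Nu|/not_unit_kernel [x x0]] := boolP (l%:M - G \in unitmx).
    have [||c c0 hc] := @unit_psd_coercive _ r n (l%:M - G) _ Nu.
    - by rewrite linearB /= tr_scalar_mx gram_tr.
    - by move=> Y; rewrite formE subr_ge0; exact: Ll.
    have : L (l - c).
      by move=> Y; have := hc Y; rewrite formE mulrBl; lra.
    by move=> /(ge_inf (ex_intro _ 0 L0)); rewrite -/l; lra.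
  rewrite mulmxBr mul_mx_scalar => /eqP; rewrite subr_eq0 => /eqP xG.
  by apply/eigenvalueP; exists x.
apply: (le_trans (y := l * fnorm X ^+ 2)); first by rewrite -tr_gram; exact: Ll.
rewrite ler_wpM2r ?sqr_ge0 // -[leLHS]sqr_sqrtr // ler_pXn2r ?nnegrE //;
  rewrite ?sqrtr_ge0 ?sigma_max_ge0 //.
apply: ub_le_sup; first exact: singular_value_ubound.
by split; rewrite ?sqrtr_ge0 // sqr_sqrtr.
Qed.

(* Expand [0 <= fnorm (X M M^T - s^2 X) ^ 2] and use the bound for [M^T]. *)
Lemma fnorm_mulmx_le (R : realType) (r m n : nat)
    (M : 'M[R]_(m, n)) (X : 'M[R]_(r, m)) :
  fnorm (X *m M) ^+ 2 <= sigma_max M ^+ 2 * fnorm X ^+ 2.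
Proof.
set s2 := sigma_max M ^+ 2; have s20 : 0 <= s2 by exact: sqr_ge0.
have h := fnorm_mulmx_tr_le M (X *m M).
have trE : \tr (X *m M *m M^T *m X^T) = fnorm (X *m M) ^+ 2.
  by rewrite fnorm_sqr_tr trmx_mul !mulmxA.
(* The expansion only yields [s2] times the claim, so [s2 = 0] is treated apart: there
   [X *m M *m M^T] vanishes, and with it the trace [trE]. *)
have [s0|sN0] := eqVneq s2 0.
  rewrite -/s2 s0 mul0r in h.
  have XMM : X *m M *m M^T = 0.
    by apply: fnorm_sqr_eq0; apply/eqP; rewrite eq_le h sqr_ge0.
  by rewrite -trE XMM mul0mx mxtrace0 mulr_ge0 ?sqr_ge0.
have sgt0 : 0 < s2 by rewrite lt_def sN0.
have := sqr_ge0 (fnorm (X *m M *m M^T + - s2 *: X)).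
rewrite fnorm_sqrD trE; rewrite -/s2 in h => pos.
by rewrite -(ler_pM2l sgt0); nra.
Qed.

(* With [P] the projection onto the row space of [M], [G - l P + (1 - P)] is
   singular for the largest lower bound [l] of the Rayleigh quotient of the
   Gram matrix [G] on that row space. *)
Lemma sigma_min_fnorm_le (R : realType) (r m n : nat)
    (M : 'M[R]_(m, n)) (Z : 'M[R]_(r, m)) :
  sigma_min M ^+ 2 * fnorm (Z *m M) ^+ 2 <= fnorm (Z *m M *m M^T) ^+ 2.
Proof.
have [->|ZM0] := eqVneq (Z *m M) 0.
  by rewrite mul0mx !fnorm0 expr0n mulr0.
have [MP _ _ Psym] := pseudoinverseP M.
rewrite -mulmxA in MP.
set P := _ *m M in Psym MP.
have PE : P = pseudoinverse M *m M by [].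
have PP : P *m P = P by rewrite {1}/P -mulmxA MP.
clearbody P.
pose G := M^T *m M.
have GP : G *m P = G by rewrite -mulmxA MP.
have PG : P *m G = G by rewrite -[P *m G]trmxK trmx_mul Psym gram_tr GP gram_tr.
pose L := [set l : R | forall Y : 'M[R]_(r, n),
  l * fnorm (Y *m P) ^+ 2 <= \tr (Y *m G *m Y^T)].
have L0 : L 0 by move=> Y; rewrite mul0r tr_gram sqr_ge0.
have ZMP : Z *m M *m P = Z *m M by rewrite -mulmxA MP.
(* The nonzero matrix [Z *m M] is fixed by [P], so its Rayleigh quotient bounds [L]. *)
have Lub : has_ubound L.
  exists (\tr (Z *m M *m G *m (Z *m M)^T) / fnorm (Z *m M) ^+ 2) => l /(_ (Z *m M)).
  by rewrite ZMP ler_pdivlMr // fnorm_sqr_gt0.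
pose l := sup L.
have l0 : 0 <= l by exact: ub_le_sup.
have Ll : L l.
  move=> Y; have [->|Y0] := eqVneq (Y *m P) 0.
    by rewrite fnorm0 expr0n mulr0 tr_gram sqr_ge0.
  rewrite -ler_pdivlMr ?fnorm_sqr_gt0 //.
  apply: ge_sup; first by exists 0.
  by move=> t /(_ Y) tY; rewrite ler_pdivlMr ?fnorm_sqr_gt0.
(* This is [G - l] on the row space of [M] and the identity on the orthogonal complement, so a
   kernel vector must lie in the row space. *)
pose N := G - l *: P + (1%:M - P).
have QT : (1%:M - P)^T = 1%:M - P by rewrite linearB /= trmx1 Psym.
have QQ : (1%:M - P) *m (1%:M - P) = 1%:M - P.
  by rewrite mulmxBr mulmx1 mulmxBl mul1mx PP subrr subr0.
have formE (Y : 'M[R]_(r, n)) : \tr (Y *m N *m Y^T) =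
    \tr (Y *m G *m Y^T) - l * fnorm (Y *m P) ^+ 2 + fnorm (Y *m (1%:M - P)) ^+ 2.
  rewrite /N mulmxDr mulmxDl linearD /= mulmxBr mulmxBl linearB /=.
  rewrite -scalemxAr -scalemxAl mxtraceZ !fnorm_sqr_tr.
  rewrite [(Y *m P)^T]trmx_mul [(Y *m (1%:M - P))^T]trmx_mul Psym QT !mulmxA.
  by rewrite -(mulmxA Y P P) PP -(mulmxA Y (1%:M - P) (1%:M - P)) QQ.
have [x x0 xN] : exists2 x : 'rV[R]_n, x != 0 & x *m N = 0.
  apply: not_unit_kernel; apply/negP => Nu.
  have [||c c0 hc] := @unit_psd_coercive _ r n N _ Nu.
  - by rewrite /N !linearD /= !linearN /= !linearZ /= trmx1 Psym gram_tr.
  - by move=> Y; rewrite formE addr_ge0 ?sqr_ge0 // subr_ge0; exact: Ll.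
  (* Tested on [Y *m P], coercivity would let [l] grow by [c], against its maximality. *)
  have : L (l + c).
    move=> Y; have := hc (Y *m P); rewrite formE.
    have -> : Y *m P *m (1%:M - P) = 0 by rewrite mulmxBr mulmx1 -mulmxA PP subrr.
    have -> : Y *m P *m G *m (Y *m P)^T = Y *m G *m Y^T.
      by rewrite trmx_mul Psym mulmxA -(mulmxA _ G) GP -(mulmxA Y) PG.
    by rewrite -(mulmxA Y P P) PP fnorm0; lra.
  by move=> /(ub_le_sup Lub); rewrite -/l; lra.
have NQ : N *m (1%:M - P) = 1%:M - P.
  rewrite /N mulmxDl mulmxBl QQ -scalemxAl !mulmxBr !mulmx1 GP PP !subrr.
  by rewrite scaler0 subr0 add0r.
have xP : x *m P = x.
  apply/eqP; rewrite eq_sym -subr_eq0 -{1}(mulmx1 x) -mulmxBr -NQ mulmxA xN.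
  by rewrite mul0mx.
have xG : x *m G = l *: x.
  move: xN; rewrite /N mulmxDr !mulmxBr mulmx1 xP subrr addr0 -scalemxAr xP.
  by move=> /eqP; rewrite subr_eq0 => /eqP.
(* For [l = 0] the vector [x] would be orthogonal to the row space that contains it. Hence
   [Num.sqrt l] is a nonzero singular value. *)
have lN0 : l != 0.
  apply: contra_neq x0 => l00.
  have xM : x *m M^T = 0.
    by apply: fnorm_sqr_eq0; rewrite -tr_gram xG l00 scale0r mul0mx mxtrace0.
  by rewrite -xP -Psym PE trmx_mul mulmxA xM mul0mx.
have sl : singular_value M (Num.sqrt l).
  split; first exact: sqrtr_ge0.
  by rewrite sqr_sqrtr //; apply/eigenvalueP; exists x.
have := Ll (Z *m M); rewrite ZMP tr_gram; apply: le_trans.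
rewrite ler_wpM2r ?sqr_ge0 // -[leRHS]sqr_sqrtr // ler_pXn2r ?nnegrE //;
  rewrite ?sqrtr_ge0 ?sigma_min_ge0 //.
by apply: sigma_min_le => //; rewrite sqrtr_eq0 -ltNge lt_def lN0.
Qed.

(** The map x -> x M^T carries eigenvectors of [M^T *m M] to eigenvectors of [M *m M^T]; since
    [s != 0], it sends none of them to zero. *)
Lemma singular_value_tr (R : realType) (m n : nat) (M : 'M[R]_(m, n)) (s : R) :
  s != 0 -> singular_value M s -> singular_value M^T s.
Proof.
move=> s0 [s_ge0 /eigenvalueP [x xs x0]]; split => //.
apply/eigenvalueP; exists (x *m M^T).
  by rewrite trmxK !mulmxA -(mulmxA x) xs -scalemxAl.
apply: contra_neq x0 => xM; move/eqP: xs.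
by rewrite mulmxA xM mul0mx eq_sym scaler_eq0 expf_eq0 (negbTE s0) andbF /= => /eqP.
Qed.

Lemma sigma_min_tr (R : realType) (m n : nat) (M : 'M[R]_(m, n)) :
  sigma_min M^T = sigma_min M.
Proof.
rewrite /sigma_min; congr inf; apply/seteqP; split => s [Ms s0]; split => //.
  by rewrite -[M]trmxK; exact: singular_value_tr.
exact: singular_value_tr.
Qed.

(** * Row and column blocks *)

Lemma singular_value_diag (R : realType) (n : nat) (v : 'rV[R]_n) (i : 'I_n) :
  0 <= v 0 i -> singular_value (diag_mx v) (v 0 i).
Proof.
move=> vi; split => //; apply/eigenvalueP; exists (delta_mx 0 i).
  rewrite tr_diag_mx mulmxA -!rowE row_diag_mx -scalemxAl -rowE row_diag_mx.
  by rewrite scalerA expr2.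
apply/negP => /eqP/matrixP/(_ 0 i); rewrite !mxE !eqxx => /eqP.
by rewrite oner_eq0.
Qed.

Lemma col_scaling_tr (R : realType) (m p : nat) (B : 'M[R]_(p, m)) (J : {set 'I_m}) :
  col_scaling B J = row_scaling B^T J.
Proof.
rewrite /col_scaling /row_scaling; congr diag_mx; apply/rowP => r.
by rewrite !mxE -tr_col fnorm_tr.
Qed.

(** This lets averages over column blocks be deduced from those over row blocks, applied to
    [B^T]. *)
Lemma col_D_tr (R : realType) (m p : nat) (B : 'M[R]_(p, m)) (pr : {set 'I_m} -> R) :
  col_D B pr = row_D B^T pr.
Proof. by apply: eq_mxdiag => k; rewrite col_scaling_tr. Qed.

Lemma sigma_min_row_D_le (R : realType) (m p : nat) (A : 'M[R]_(m, p))
    (pr : {set 'I_m} -> R) (I : {set 'I_m}) (i : 'I_m) :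
  row i A != 0 -> I \in selectable pr -> i \in I ->
  sigma_min (row_D A pr) ^+ 2 <= pr I / fnorm (row i A) ^+ 2.
Proof.
move=> Ai selI iI; have prI : 0 < pr I by move: selI; rewrite inE.
pose a (k : 'I_#|selectable pr|) : 'rV[R]_#|enum_val k| := Num.sqrt (pr (enum_val k)) *:
  \row_(r < #|enum_val k|) (fnorm (row (enum_val r) A))^-1.
have DE : row_D A pr = diag_mx (\mxrow_k a k).
  by rewrite diag_mxrow; apply: eq_mxdiag => k; rewrite -linearZ.
(* [tagnat.Rank k r] is the position of entry [r] of block [k] on the long diagonal; each such
   diagonal entry is a singular value. *)
have entry k r : (\mxrow_k0 a k0) 0 (tagnat.Rank k r) =
    Num.sqrt (pr (enum_val k)) / fnorm (row (enum_val r) A).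
  by have /rowP/(_ r) := mxrowK a k; rewrite !mxE.
have s0 : 0 < Num.sqrt (pr I) / fnorm (row i A).
  by apply: divr_gt0; [rewrite sqrtr_gt0|exact: fnorm_gt0].
have -> : pr I / fnorm (row i A) ^+ 2 = (Num.sqrt (pr I) / fnorm (row i A)) ^+ 2.
  by rewrite expr_div_n (@sqr_sqrtr _ (pr I)) // ltW.
rewrite ler_pXn2r ?nnegrE ?sigma_min_ge0 //; last exact: ltW.
apply: sigma_min_le; last by rewrite gt_eqF.
pose k := enum_rank_in selI I.
have kE : enum_val k = I by rewrite enum_rankK_in //.
have ik : i \in enum_val k by rewrite kE.
pose r := enum_rank_in ik i.
have <- : (\mxrow_k0 a k0) 0 (tagnat.Rank k r) = Num.sqrt (pr I) / fnorm (row i A).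
  by rewrite entry (enum_rankK_in ik) // kE //.
rewrite DE; apply: singular_value_diag; rewrite entry.
by rewrite divr_ge0 ?sqrtr_ge0.
Qed.

Lemma row_gamma_max_bound (R : realType) (r m p : nat) (A : 'M[R]_(m, p))
    (pr : {set 'I_m} -> R) (I : {set 'I_m}) (X : 'M[R]_(r, #|I|)) :
  I \in selectable pr ->
  fnorm (X *m (row_scaling A I *m row_block A I)) ^+ 2 <=
  row_gamma_max A pr ^+ 2 * fnorm X ^+ 2.
Proof.
move=> selI; apply: le_trans (fnorm_mulmx_le _ _) _.
rewrite ler_wpM2r ?sqr_ge0 //.
have h : sigma_max (row_scaling A I *m row_block A I) <= row_gamma_max A pr.
  exact: (le_bigmax_cond _ (fun I => sigma_max (row_scaling A I *m row_block A I))).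
by rewrite ler_pXn2r ?nnegrE // ?(le_trans _ h) ?sigma_max_ge0.
Qed.

Lemma col_gamma_max_bound (R : realType) (r m p : nat) (B : 'M[R]_(p, m))
    (pr : {set 'I_m} -> R) (J : {set 'I_m}) (X : 'M[R]_(r, #|J|)) :
  J \in selectable pr ->
  fnorm (X *m (col_block B J *m col_scaling B J)^T) ^+ 2 <=
  col_gamma_max B pr ^+ 2 * fnorm X ^+ 2.
Proof.
move=> selJ; apply: le_trans (fnorm_mulmx_tr_le _ _) _.
rewrite ler_wpM2r ?sqr_ge0 //.
have h : sigma_max (col_block B J *m col_scaling B J) <= col_gamma_max B pr.
  exact: (le_bigmax_cond _ (fun J => sigma_max (col_block B J *m col_scaling B J))).
by rewrite ler_pXn2r ?nnegrE // ?(le_trans _ h) ?sigma_max_ge0.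
Qed.

(* The sum is [(D_I A_I)^T M (B_J D_J)^T] where [M] has the entries
   [c i j * fnorm (row i A) * fnorm (col j B)]. *)
Lemma fnorm_outer_sum_le (R : realType) (m p q n : nat)
    (A : 'M[R]_(m, p)) (B : 'M[R]_(q, n))
    (A_rows : forall i, row i A != 0) (B_cols : forall j, col j B != 0)
    (prI : {set 'I_m} -> R) (prJ : {set 'I_n} -> R)
    (I : {set 'I_m}) (J : {set 'I_n}) (c : 'I_m -> 'I_n -> R) :
  I \in selectable prI -> J \in selectable prJ ->
  fnorm (\sum_(i in I) \sum_(j in J)
           c i j *: ((row i A)^T *m (col j B)^T)) ^+ 2 <=
  row_gamma_max A prI ^+ 2 * col_gamma_max B prJ ^+ 2 *
  \sum_(i in I) \sum_(j in J)
     (c i j * fnorm (row i A) * fnorm (col j B)) ^+ 2.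
Proof.
move=> selI selJ.
pose M : 'M[R]_(#|I|, #|J|) := \matrix_(r, s) (c (enum_val r) (enum_val s) *
  fnorm (row (enum_val r) A) * fnorm (col (enum_val s) B)).
pose F := row_scaling A I *m row_block A I.
pose G := col_block B J *m col_scaling B J.
have -> : \sum_(i in I) \sum_(j in J) c i j *: ((row i A)^T *m (col j B)^T) =
    (M^T *m F)^T *m G^T.
  rewrite trmx_mul trmxK big_enum_val; apply/matrixP => a b.
  rewrite !mxE summxE; under eq_bigr do rewrite big_enum_val summxE.
  rewrite exchange_big /=; apply: eq_bigr => s _.
  rewrite mxE mulr_suml; apply: eq_bigr => r _.
  rewrite /F /G /row_scaling /col_scaling mul_diag_mx mul_mx_diag !mxE big_ord1 !mxE.
  field; rewrite !gt_eqF ?fnorm_gt0 //.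
have := @col_gamma_max_bound _ _ _ _ B _ _ (M^T *m F)^T selJ.
rewrite fnorm_tr -/G => /le_trans; apply.
rewrite -[leRHS]mulrA [leRHS]mulrCA ler_wpM2l ?sqr_ge0 //.
have := @row_gamma_max_bound _ _ _ _ A _ _ M^T selI.
rewrite -/F => /le_trans; apply.
rewrite fnorm_tr fnorm_sqrE ler_wpM2l ?sqr_ge0 // [leRHS]big_enum_val.
apply: ler_sum => r _; rewrite [leRHS]big_enum_val.
by apply: ler_sum => s _; rewrite mxE.
Qed.

(** * One iteration *)

(** The weights are left out: they may depend on the history, whereas this quantity can be averaged
    over [I] and [J] with [E] fixed. *)
Definition block_energy (R : realType) (m p q n : nat) (A : 'M[R]_(m, p))
    (B : 'M[R]_(q, n)) (E : 'M[R]_(p, q)) (I : {set 'I_m}) (J : {set 'I_n}) : R :=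
  \sum_(i in I) \sum_(j in J)
    (A *m E *m B) i j ^+ 2 / (fnorm (row i A) ^+ 2 * fnorm (col j B) ^+ 2).

Lemma block_energy_ge0 (R : realType) (m p q n : nat) (A : 'M[R]_(m, p))
    (B : 'M[R]_(q, n)) (E : 'M[R]_(p, q)) (I : {set 'I_m}) (J : {set 'I_n}) :
  0 <= block_energy A B E I J.
Proof.
rewrite sumr_ge0 // => i _; rewrite sumr_ge0 // => j _.
by rewrite divr_ge0 ?sqr_ge0 // mulr_ge0 ?sqr_ge0.
Qed.

Lemma row_mulmx_col (R : realType) (m p q n : nat) (A : 'M[R]_(m, p))
    (E : 'M[R]_(p, q)) (B : 'M[R]_(q, n)) i j :
  (row i A *m E *m col j B) 0 0 = (A *m E *m B) i j.
Proof.
rewrite -row_mul !mxE; apply: eq_bigr => k _; by rewrite !mxE.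
Qed.

Lemma residual_error (R : realType) (m p q n : nat) (A : 'M[R]_(m, p))
    (B : 'M[R]_(q, n)) (C : 'M[R]_(m, n)) (Xs X : 'M[R]_(p, q)) i j :
  A *m Xs *m B = C -> residual A B C X i j = - (A *m (X - Xs) *m B) i j.
Proof.
by move=> <-; rewrite /residual row_mulmx_col mulmxBr mulmxBl !mxE opprB.
Qed.

(** The constant $\psi$ of the convergence rate. *)
Definition contraction_constant (R : realType) (m p q n : nat) (A : 'M[R]_(m, p))
    (B : 'M[R]_(q, n)) (prI : {set 'I_m} -> R) (prJ : {set 'I_n} -> R)
    (umin umax vmin vmax : R) : R :=
  (umin * vmin) /
    (umax * vmax * row_gamma_max A prI ^+ 2 * col_gamma_max B prJ ^+ 2).

(** The decrease is deterministic: it holds for each selectable pair of blocks and all weights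
    within the bounds, before any expectation is taken. *)
Lemma grabk_step_le (R : realType) (m p q n : nat) (A : 'M[R]_(m, p))
    (B : 'M[R]_(q, n)) (C : 'M[R]_(m, n))
    (A_rows : forall i, row i A != 0) (B_cols : forall j, col j B != 0)
    (prI : {set 'I_m} -> R) (prJ : {set 'I_n} -> R)
    (umin umax vmin vmax : R) (u : 'I_m -> R) (v : 'I_n -> R)
    (umin_gt0 : 0 < umin) (vmin_gt0 : 0 < vmin)
    (u_bounds : forall i, umin <= u i <= umax)
    (v_bounds : forall j, vmin <= v j <= vmax)
    (eta : R) (I : {set 'I_m}) (J : {set 'I_n}) (Xs X : 'M[R]_(p, q)) :
  0 < eta < 2 ->
  A *m Xs *m B = C -> I \in selectable prI -> J \in selectable prJ ->
  fnorm (X + (eta * adaptive_step A B C u v I J X)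
             *: direction A B C u v I J X - Xs) ^+ 2 <=
  fnorm (X - Xs) ^+ 2
    - eta * (2 - eta) * contraction_constant A B prI prJ umin umax vmin vmax
      * block_energy A B (X - Xs) I J.
Proof.
move=> /andP[eta0 eta2] AXB selI selJ; rewrite addrAC.
set E := X - Xs; set S := block_energy _ _ _ _ _; set d := direction _ _ _ _ _ _ _ _.
rewrite /adaptive_step -/d; set N := \sum_(i in I) _.
have fA i : 0 < fnorm (row i A) by exact: fnorm_gt0.
have fB j : 0 < fnorm (col j B) by exact: fnorm_gt0.
have u0 i : 0 < u i by apply: lt_le_trans umin_gt0 _; case/andP: (u_bounds i).
have v0 j : 0 < v j by apply: lt_le_trans vmin_gt0 _; case/andP: (v_bounds j).
have S0 : 0 <= S by exact: block_energy_ge0.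
have w0 i j : 0 < weight A B u v i j.
  by rewrite /weight mulr_gt0 // divr_gt0 // exprn_gt0.
have N0 : 0 <= N.
  rewrite sumr_ge0 // => i _; rewrite sumr_ge0 // => j _.
  by rewrite mulr_ge0 ?sqr_ge0 // ltW.
(* By cyclicity of the trace, the inner product of [E] with the outer product of row i of A and
   column j of B is the (i, j) entry of A E B, which is minus the residual. *)
have innerE : \tr (E *m d^T) = - N.
  rewrite /d /direction /N linear_sum mulmx_sumr linear_sum /= -sumrN.
  apply: eq_bigr => i _; rewrite linear_sum mulmx_sumr linear_sum /= -sumrN.
  apply: eq_bigr => j _; rewrite linearZ /= -scalemxAr mxtraceZ trmx_mul !trmxK.
  rewrite mulmxA mxtrace_mulC mulmxA /mxtrace big_ord1 row_mulmx_col.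
  by rewrite (residual_error _ _ _ AXB) -/E; ring.
(* Each normalised squared coefficient of [d] is [u i * v j] times its term in [N]; the upper bounds
   on the weights come out here, the lower ones in [NS]. *)
have dN : fnorm d ^+ 2 <=
    umax * vmax * row_gamma_max A prI ^+ 2 * col_gamma_max B prJ ^+ 2 * N.
  apply: le_trans (fnorm_outer_sum_le A_rows B_cols _ selI selJ) _.
  set g := row_gamma_max A prI ^+ 2; set h := col_gamma_max B prJ ^+ 2.
  have -> : umax * vmax * g * h * N = g * h * (umax * vmax * N) by ring.
  rewrite ler_wpM2l ?(mulr_ge0 (sqr_ge0 _) (sqr_ge0 _)) // /N mulr_sumr.
  apply: ler_sum => i _.
  rewrite mulr_sumr; apply: ler_sum => j _.
  set r := residual _ _ _ _ _ _.
  have -> : (weight A B u v i j * r * fnorm (row i A) * fnorm (col j B)) ^+ 2 =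
      u i * v j * (weight A B u v i j * r ^+ 2).
    by rewrite /weight; field; rewrite !gt_eqF.
  rewrite ler_wpM2r ?(mulr_ge0 (ltW _) (sqr_ge0 _)) //.
  have /andP[_ ui] := u_bounds i; have /andP[_ vj] := v_bounds j.
  by rewrite ler_pM // ltW.
have NS : umin * vmin * S <= N.
  rewrite /S /block_energy mulr_sumr; apply: ler_sum => i _.
  rewrite mulr_sumr; apply: ler_sum => j _.
  rewrite (residual_error _ _ _ AXB) -/E sqrrN /weight.
  set z := _ ^+ 2; set a := fnorm _; set b := fnorm _.
  have -> : u i / a ^+ 2 * (v j / b ^+ 2) * z = u i * v j * (z / (a ^+ 2 * b ^+ 2)).
    by field; rewrite /a /b !gt_eqF.
  rewrite ler_wpM2r ?(divr_ge0 (sqr_ge0 _) (mulr_ge0 (sqr_ge0 _) (sqr_ge0 _))) //.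
  have /andP[ui _] := u_bounds i; have /andP[vj _] := v_bounds j.
  by rewrite ler_pM // ltW.
rewrite fnorm_sqrD innerE /contraction_constant.
move: dN; set D := fnorm d ^+ 2; set G := umax * vmax * _ * _ => dN.
have D0 : 0 <= D by exact: sqr_ge0.
(* If [D = 0] the step is the junk value [N / 0 = 0], but then [N = - <E, d> = 0]. *)
have [D00|DN0] := eqVneq D 0.
  have S00 : S = 0.
    have : N = 0.
      by rewrite -[N]opprK -innerE (fnorm_sqr_eq0 D00) trmx0 mulmx0 mxtrace0 oppr0.
    move=> NE; apply/eqP; rewrite eq_le S0 andbT.
    by rewrite -(pmulr_rle0 _ (mulr_gt0 umin_gt0 vmin_gt0)) -NE.
  by rewrite S00 D00 invr0 !(mulr0, mul0r, addr0, subr0).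
have Dgt0 : 0 < D by rewrite lt_def DN0.
have Ngt0 : 0 < N.
  by rewrite lt_def N0 andbT; apply: contraTneq dN => ->; rewrite mulr0 -ltNge.
(* Positivity of the gammas is not assumed; it is forced by [0 < D <= G * N]. *)
have Ggt0 : 0 < G by rewrite -(pmulr_lgt0 _ Ngt0); exact: lt_le_trans dN.
have -> : fnorm E ^+ 2 + 2 * (eta * (N / D)) * - N + (eta * (N / D)) ^+ 2 * D =
    fnorm E ^+ 2 - eta * (2 - eta) * (N ^+ 2 / D) by field.
rewrite lerD2l lerN2 -[leLHS]mulrA ler_wpM2l //.
  by rewrite mulr_ge0 ?subr_ge0 // ltW.
have -> : umin * vmin / G * S = umin * vmin * S / G by ring.
rewrite ler_pdivlMr // mulrAC ler_pdivrMr // expr2 -[leRHS]mulrA.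
apply: ler_pM => //; last by rewrite mulrC.
by rewrite mulr_ge0 // mulr_ge0 // ltW.
Qed.

(** After exchanging the sums, [f i] is multiplied by the sum of [pr I / fnorm (row i A) ^+ 2] over
    all [I] containing [i], and one selectable [I] already gives the squared singular value. *)
Lemma sigma_min_row_D_average (R : realType) (m p : nat) (A : 'M[R]_(m, p))
    (A_rows : forall i, row i A != 0) (pr : {set 'I_m} -> R)
    (pr_ge0 : forall I, 0 <= pr I)
    (pr_cover : forall i : 'I_m, exists2 I, I \in selectable pr & i \in I)
    (f : 'I_m -> R) :
  (forall i, 0 <= f i) ->
  sigma_min (row_D A pr) ^+ 2 * \sum_i f i <=
  \sum_I pr I * \sum_(i in I) f i / fnorm (row i A) ^+ 2.
Proof.
move=> f0; have term_ge0 (I : {set 'I_m}) i : 0 <= pr I * (f i / fnorm (row i A) ^+ 2).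
  by rewrite mulr_ge0 // divr_ge0 // sqr_ge0.
under [leRHS]eq_bigr do rewrite mulr_sumr.
rewrite (exchange_big_dep predT) //= mulr_sumr; apply: ler_sum => i _.
have [I selI iI] := pr_cover i.
rewrite (bigD1 I) //=; apply: ler_wpDr; first by rewrite sumr_ge0.
rewrite [leRHS]mulrCA [leRHS]mulrC ler_wpM2r //.
exact: sigma_min_row_D_le.
Qed.

Lemma block_energy_average (R : realType) (m p q n : nat) (A : 'M[R]_(m, p))
    (B : 'M[R]_(q, n))
    (A_rows : forall i, row i A != 0) (B_cols : forall j, col j B != 0)
    (prI : {set 'I_m} -> R) (prJ : {set 'I_n} -> R)
    (prI_ge0 : forall I, 0 <= prI I) (prJ_ge0 : forall J, 0 <= prJ J)
    (prI_cover : forall i : 'I_m, exists2 S, S \in selectable prI & i \in S)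
    (prJ_cover : forall j : 'I_n, exists2 S, S \in selectable prJ & j \in S)
    (Y : 'M[R]_(m, n)) (E : 'M[R]_(p, q)) :
  E = A^T *m Y *m B^T ->
  sigma_min (row_D A prI) ^+ 2 * sigma_min (col_D B prJ) ^+ 2
    * sigma_min A ^+ 2 * sigma_min B ^+ 2 * fnorm E ^+ 2 <=
  \sum_I \sum_J prI I * prJ J * block_energy A B E I J.
Proof.
move=> EY; set a := sigma_min (row_D A prI) ^+ 2; set b := sigma_min (col_D B prJ) ^+ 2.
(* The form of [E] puts E B in the range of A^T and E in the range of right multiplication by B^T;
   the lower bound is used once for each factor. *)
have energyE : sigma_min A ^+ 2 * sigma_min B ^+ 2 * fnorm E ^+ 2 <=
    fnorm (A *m E *m B) ^+ 2.
  have := sigma_min_fnorm_le A (Y *m B^T *m B)^T.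
  rewrite -(fnorm_tr (_ *m A)) -(fnorm_tr (_ *m A^T)) !trmx_mul !trmxK.
  rewrite !mulmxA -EY.
  have -> : A *m A^T *m Y *m B^T *m B = A *m E *m B by rewrite EY !mulmxA.
  move=> h; apply: le_trans _ h; rewrite -mulrA.
  rewrite ler_wpM2l ?sqr_ge0 // -(sigma_min_tr B).
  by have := sigma_min_fnorm_le B^T (A^T *m Y); rewrite trmxK -EY.
(* The average over pairs becomes an iterated one, so that the one-sided average applies first to
   rows and then, for each row, to columns. *)
have -> : \sum_I \sum_J prI I * prJ J * block_energy A B E I J =
    \sum_I prI I * \sum_(i in I) (\sum_J prJ J * \sum_(j in J)
       (A *m E *m B) i j ^+ 2 / fnorm (col j B) ^+ 2) / fnorm (row i A) ^+ 2.
  apply: eq_bigr => I _; under eq_bigr do rewrite -mulrA.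
  rewrite -mulr_sumr; congr (_ * _); under [RHS]eq_bigr do rewrite mulr_suml.
  rewrite [RHS]exchange_big /=; apply: eq_bigr => J _.
  rewrite mulr_sumr; apply: eq_bigr => i _; rewrite -mulrA mulr_suml.
  congr (_ * _); apply: eq_bigr => j _.
  by rewrite -mulrA -invfM [X in _ / X]mulrC.
apply: le_trans (sigma_min_row_D_average A_rows prI_ge0 prI_cover _); last first.
  move=> i; rewrite sumr_ge0 // => J _; rewrite mulr_ge0 // sumr_ge0 // => j _.
  by rewrite divr_ge0 // sqr_ge0.
have -> : a * b * sigma_min A ^+ 2 * sigma_min B ^+ 2 * fnorm E ^+ 2 =
  a * (b * (sigma_min A ^+ 2 * sigma_min B ^+ 2 * fnorm E ^+ 2)) by ring.
rewrite ler_wpM2l ?sqr_ge0 //.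
apply: (@le_trans _ _ (b * fnorm (A *m E *m B) ^+ 2)).
  by rewrite ler_wpM2l ?sqr_ge0.
rewrite fnorm_sqrE mulr_sumr; apply: ler_sum => i _.
have := @sigma_min_row_D_average _ _ _ B^T _ prJ prJ_ge0 prJ_cover
  (fun j => (A *m E *m B) i j ^+ 2).
rewrite -col_D_tr; under [in leRHS]eq_bigr do under eq_bigr do rewrite -tr_col fnorm_tr.
apply => [j|j]; last exact: sqr_ge0.
by rewrite -tr_col -trmx0 (inj_eq trmx_inj).
Qed.

(** * Histories of selections *)

(** Outside the image of [Z] the factor [g] takes the default [v0], so a property shared by [v0] and
    the values of [f] holds for every value of [g]. *)
Lemma factor_through (T V W : Type) (v0 : V) (Z : T -> W) (f : T -> V) :
  (forall w w', Z w = Z w' -> f w = f w') ->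
  exists g : W -> V, (forall w, f w = g (Z w)) /\
    forall z, (exists2 w, Z w = z & g z = f w) \/ g z = v0.
Proof.
move=> Zf; exists (fun z => if pselect (exists w, Z w = z) is left e
  then f (sval (cid e)) else v0); split=> [w|z].
  by case: pselect => [e|[]]; [case: (cid e) => w' /= /Zf|exists w].
case: pselect => [e|_]; last by right.
by left; case: (cid e) => w /=; exists w.
Qed.

(** The variable is a finite combination of indicators of the fibres of [Z], so its integral is a
    finite sum. *)
Lemma expectation_finite (R : realType) (d : measure_display) (T : measurableType d)
    (P : probability T R) (F : finType) (Z : T -> F) (g : F -> R) :
  (forall z, measurable (Z @^-1` [set z])) -> (forall z, 0 <= g z) ->
  'E_P[g \o Z]%E = (\sum_z g z * fine (P (Z @^-1` [set z])))%:E.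
Proof.
move=> mZ g0; rewrite unlock.
have -> : (fun w => ((g \o Z) w)%:E) =
    (fun w => \sum_(z : F) (g z)%:E * (\1_(Z @^-1` [set z]) w)%:E)%E.
  apply/funext => w /=; rewrite (bigD1 (Z w)) //= big1 ?adde0.
    by rewrite indicE mem_set // mule1.
  by move=> z zw; rewrite indicE memNset ?mule0 //= => /esym/eqP; rewrite (negbTE zw).
rewrite ge0_integral_sum //; last 2 first.
- move=> z; apply: measurable_funeM; apply/measurable_EFinP; exact: measurable_indic.
- by move=> z w _; rewrite mule_ge0 ?lee_fin.
rewrite -sumEFin; apply: eq_bigr => z _.
rewrite ge0_integralZl_EFin //; last first.
- by apply/measurable_EFinP; exact: measurable_indic.
rewrite integral_indic // setIT EFinM fineK //; exact: fin_num_measure.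
Qed.

(** Only iterations strictly before [k] are recorded, those that determine the iterate [k]. The
    values form a finite type. *)
Definition history (T : Type) (m n : nat) (I : nat -> T -> {set 'I_m})
    (J : nat -> T -> {set 'I_n}) (k : nat) (w : T) :
    {ffun 'I_k -> {set 'I_m} * {set 'I_n}} :=
  [ffun l : 'I_k => (I l w, J l w)].

Lemma historyP (T : Type) (m n : nat) (I : nat -> T -> {set 'I_m})
    (J : nat -> T -> {set 'I_n}) (k : nat) (w w' : T) :
  history I J k w = history I J k w' <->
  forall l, (l < k)%N -> I l w = I l w' /\ J l w = J l w'.
Proof.
split=> [/ffunP h l lk|h].
  by have := h (Ordinal lk); rewrite !ffunE => -[].
by apply/ffunP => l; rewrite !ffunE; have [-> ->] := h l (ltn_ord l).
Qed.

Lemma set_mem_cons (K : eqType) (t : K) (s : seq K) :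
  [set` t :: s] = t |` [set` s].
Proof.
apply/seteqP; split => x /=; rewrite inE; first by case/predU1P; [left|right].
by case=> [->|xs]; apply/predU1P; [left|right].
Qed.

(** Lists the selections recorded in a history in the form that [mutually_independent] expects. *)
Definition past (k : nat) : seq (nat + nat) :=
  [seq inl l | l <- iota 0 k] ++ [seq inr l | l <- iota 0 k].

Lemma mem_past k t : (t \in past k) = (match t with inl l | inr l => l end < k)%N.
Proof.
rewrite /past mem_cat; case: t => l.
  rewrite mem_map => [|? ? []//]; rewrite mem_iota /= add0n.
  by case: mapP => [[]//|_]; rewrite orbF.
rewrite (mem_map (f := inr)) => [|? ? []//]; rewrite mem_iota /= add0n.
by case: mapP => [[]//|_].
Qed.

Lemma uniq_past k : uniq (past k).
Proof.
rewrite /past cat_uniq !map_inj_uniq ?iota_uniq /=; try by move=> ? ? [].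
by rewrite andbT; apply/hasPn => t /mapP [l _ ->]; apply/mapP => -[].
Qed.

Definition selection_event (T : Type) (m n : nat) (I : nat -> T -> {set 'I_m})
    (J : nat -> T -> {set 'I_n}) (a : nat -> {set 'I_m}) (b : nat -> {set 'I_n})
    (t : nat + nat) : set T :=
  match t with
  | inl l => I l @^-1` [set a l]
  | inr l => J l @^-1` [set b l]
  end.

(** The values of [a] and [b] from [k] on are free, which leaves room to prescribe the selection at
    iteration [k]. *)
Lemma history_event (T : Type) (m n : nat) (I : nat -> T -> {set 'I_m})
    (J : nat -> T -> {set 'I_n}) (a : nat -> {set 'I_m}) (b : nat -> {set 'I_n})
    (k : nat) (w0 : T) :
  (forall l, (l < k)%N -> a l = I l w0 /\ b l = J l w0) ->
  history I J k @^-1` [set history I J k w0] =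
  \bigcap_(t in [set` past k]) selection_event I J a b t.
Proof.
move=> ab; apply/seteqP; split => w /=.
  by move=> /historyP h [l|l] /=; rewrite mem_past => lk;
    have [hI hJ] := h l lk; have [aE bE] := ab l lk; rewrite ?aE ?bE.
move=> h; apply/historyP => l lk; have [<- <-] := ab l lk; split.
  by apply: (h (inl l)); rewrite /= mem_past.
by apply: (h (inr l)); rewrite /= mem_past.
Qed.

Lemma selection_event_generated (T : Type) (m n : nat) (I : nat -> T -> {set 'I_m})
    (J : nat -> T -> {set 'I_n}) a b t :
  selection_events I J t (selection_event I J a b t).
Proof.
by case: t => l; [exists [set a l]|exists [set b l]] => //; rewrite setTI.
Qed.

Lemma measurable_history (R : realType) (m n : nat)
    (prI : {set 'I_m} -> R) (prJ : {set 'I_n} -> R)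
    (d : measure_display) (T : measurableType d) (P : probability T R)
    (I : nat -> T -> {set 'I_m}) (J : nat -> T -> {set 'I_n})
    (I_law : forall k, has_law P (I k) prI)
    (J_law : forall k, has_law P (J k) prJ) k h : measurable (history I J k @^-1` [set h]).
Proof.
have [->|/set0P [w0 /= <-]] := eqVneq (history I J k @^-1` [set h]) set0.
  exact: measurable0.
rewrite (@history_event _ _ _ I J (I ^~ w0) (J ^~ w0)) //.
apply: fin_bigcap_measurable; first exact: finite_seq.
by case=> l _ /=; [have [] := I_law l (I l w0)|have [] := J_law l (J l w0)].
Qed.

Lemma measurable_history_selection (R : realType) (m n : nat)
    (prI : {set 'I_m} -> R) (prJ : {set 'I_n} -> R)
    (d : measure_display) (T : measurableType d) (P : probability T R)
    (I : nat -> T -> {set 'I_m}) (J : nat -> T -> {set 'I_n})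
    (I_law : forall k, has_law P (I k) prI)
    (J_law : forall k, has_law P (J k) prJ) k z :
  measurable ((fun w => (history I J k w, (I k w, J k w))) @^-1` [set z]).
Proof.
case: z => h [a b].
rewrite (_ : _ @^-1` _ = (history I J k @^-1` [set h]) `&`
  (I k @^-1` [set a] `&` J k @^-1` [set b])).
  apply: measurableI; first exact: (measurable_history I_law J_law).
  by apply: measurableI; [have [] := I_law k a|have [] := J_law k b].
by apply/seteqP; split => w /=; [case=> -> -> ->|case=> -> [-> ->]].
Qed.

Lemma history_selection_prob (R : realType) (m n : nat)
    (prI : {set 'I_m} -> R) (prJ : {set 'I_n} -> R)
    (d : measure_display) (T : measurableType d) (P : probability T R)
    (I : nat -> T -> {set 'I_m}) (J : nat -> T -> {set 'I_n})
    (I_law : forall k, has_law P (I k) prI)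
    (J_law : forall k, has_law P (J k) prJ)
    (IJ_indep : mutually_independent P (selection_events I J)) k h a b :
  P ((fun w => (history I J k w, (I k w, J k w))) @^-1` [set (h, (a, b))]) =
  (P (history I J k @^-1` [set h]) * ((prI a)%:E * (prJ b)%:E))%E.
Proof.
have -> : (fun w => (history I J k w, (I k w, J k w))) @^-1` [set (h, (a, b))] =
    (I k @^-1` [set a]) `&` (J k @^-1` [set b] `&` (history I J k @^-1` [set h])).
  by apply/seteqP; split => w /=; [case=> -> -> ->|case=> -> [-> ->]].
have [->|/set0P [w0 /= <-]] := eqVneq (history I J k @^-1` [set h]) set0.
  by rewrite !setI0 measure0 mul0e.
(* The history of [w0] is continued by [a] and [b] at iteration [k], so that past and present events
   belong to one family and independence applies to both sides. *)
pose a' l := if (l < k)%N then I l w0 else a.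
pose b' l := if (l < k)%N then J l w0 else b.
rewrite (@history_event _ _ _ I J a' b'); last by rewrite /a' /b' => l ->.
have -> : I k @^-1` [set a] = selection_event I J a' b' (inl k) by rewrite /= /a' ltnn.
have -> : J k @^-1` [set b] = selection_event I J a' b' (inr k) by rewrite /= /b' ltnn.
rewrite -bigcap_setU1 -set_mem_cons -bigcap_setU1 -set_mem_cons.
have gen t := @selection_event_generated _ _ _ I J a' b' t.
rewrite !IJ_indep //; last 2 first.
- exact: uniq_past.
- by rewrite /= uniq_past inE !mem_past ltnn.
rewrite !big_cons /= /a' /b' ltnn.
have [_ ->] := I_law k a; have [_ ->] := J_law k b.
by rewrite muleA muleC.
Qed.

(** * Convergence rate *)

Lemma direction_range (R : realType) (m p q n : nat) (A : 'M[R]_(m, p))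
    (B : 'M[R]_(q, n)) (C : 'M[R]_(m, n)) u v I J X :
  exists Y : 'M[R]_(m, n), direction A B C u v I J X = A^T *m Y *m B^T.
Proof.
exists (\sum_(i in I) \sum_(j in J) (weight A B u v i j * residual A B C X i j)
  *: ((delta_mx 0 i : 'rV_m)^T *m (delta_mx j 0 : 'cV_n)^T)).
rewrite mulmx_sumr mulmx_suml; apply: eq_bigr => i _.
rewrite mulmx_sumr mulmx_suml; apply: eq_bigr => j _.
by rewrite -scalemxAr -scalemxAl rowE colE !trmx_mul !mulmxA.
Qed.

(** In G = G M G, symmetry of G M gives G = M^T G^T G, and symmetry of M G gives G = G G^T M^T. *)
Lemma pseudoinverse_tr_factor (R : realType) (m n : nat) (M : 'M[R]_(m, n)) :
  (exists Y, pseudoinverse M = M^T *m Y) /\ (exists Y, pseudoinverse M = Y *m M^T).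
Proof.
have [_ GMG MGT GMT] := pseudoinverseP M; set G := pseudoinverse M in GMG MGT GMT *.
split.
  by exists (G^T *m G); rewrite mulmxA -trmx_mul GMT GMG.
by exists (G *m G^T); rewrite -mulmxA -trmx_mul MGT mulmxA GMG.
Qed.

Lemma pseudoinverse_solution (R : realType) (m p q n : nat) (A : 'M[R]_(m, p))
    (B : 'M[R]_(q, n)) (C : 'M[R]_(m, n)) :
  (exists X, A *m X *m B = C) ->
  A *m (pseudoinverse A *m C *m pseudoinverse B) *m B = C.
Proof.
move=> [X <-]; have [hA _ _ _] := pseudoinverseP A; have [hB _ _ _] := pseudoinverseP B.
rewrite !mulmxA hA -!mulmxA; congr (_ *m (_ *m _)).
by rewrite mulmxA hB.
Qed.

(** The start, the solution [pseudoinverse A *m C *m pseudoinverse B] and every direction lie in one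
    subspace, which the error therefore never leaves. *)
Lemma grabk_error_range (R : realType) (m p q n : nat) (A : 'M[R]_(m, p))
    (B : 'M[R]_(q, n)) (C : 'M[R]_(m, n)) eta u v I J (X0 : 'M[R]_(p, q)) k :
  (exists Y : 'M[R]_(m, n), X0 = A^T *m Y *m B^T) ->
  exists Y : 'M[R]_(m, n), grabk A B C eta u v I J X0 k
    - pseudoinverse A *m C *m pseudoinverse B = A^T *m Y *m B^T.
Proof.
move=> X0_range; elim: k => [|k [Y XY]] /=.
  have [Y ->] := X0_range.
  have [[YA ->] _] := pseudoinverse_tr_factor A.
  have [_ [YB ->]] := pseudoinverse_tr_factor B.
  by exists (Y - YA *m C *m YB); rewrite mulmxBr mulmxBl !mulmxA.
set X := grabk _ _ _ _ _ _ _ _ _ _ in XY *.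
have [D ->] := direction_range A B C (u k) (v k) (I k) (J k) X.
rewrite addrAC XY; eexists (Y + _ *: D).
by rewrite mulmxDr mulmxDl -scalemxAr -scalemxAl.
Qed.

Lemma grabk_solution (R : realType) (m p q n : nat) (A : 'M[R]_(m, p))
    (B : 'M[R]_(q, n)) (C : 'M[R]_(m, n)) eta u v I J (Xs : 'M[R]_(p, q)) k :
  A *m Xs *m B = C -> grabk A B C eta u v I J Xs k = Xs.
Proof.
move=> AXB; elim: k => //= k ->.
rewrite /direction big1 ?scaler0 ?addr0 // => i _; rewrite big1 // => j _.
by rewrite (residual_error _ _ _ AXB) subrr mulmx0 mul0mx mxE oppr0 mulr0 scale0r.
Qed.

Lemma grabk_nonanticipating (R : realType) (T : Type) (m p q n : nat)
    (A : 'M[R]_(m, p)) (B : 'M[R]_(q, n)) (C : 'M[R]_(m, n)) eta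
    (I : nat -> T -> {set 'I_m}) (J : nat -> T -> {set 'I_n})
    (u : nat -> T -> 'I_m -> R) (v : nat -> T -> 'I_n -> R)
    (X0 : 'M[R]_(p, q)) k w w' :
  nonanticipating I J u -> nonanticipating I J v ->
  (forall l, (l < k)%N -> I l w = I l w' /\ J l w = J l w') ->
  grabk A B C eta (u ^~ w) (v ^~ w) (I ^~ w) (J ^~ w) X0 k =
  grabk A B C eta (u ^~ w') (v ^~ w') (I ^~ w') (J ^~ w') X0 k.
Proof.
move=> uP vP; elim: k => //= k IH h.
have /= -> := IH (fun l lk => h l (leqW lk)).
(* The weights at iteration [k] may see selection [k] itself, which is covered because [h] reaches
   up to [k]. *)
by have [-> ->] := h k (ltnSn k); rewrite (uP k w w' h) (vP k w w' h).
Qed.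

Lemma contraction_constant_ge0 (R : realType) (m p q n : nat) (A : 'M[R]_(m, p))
    (B : 'M[R]_(q, n)) prI prJ (umin umax vmin vmax : R) :
  0 < umin -> 0 < vmin -> umin <= umax -> vmin <= vmax ->
  0 <= contraction_constant A B prI prJ umin umax vmin vmax.
Proof.
move=> u0 v0 uu vv; have umax0 := ltW (lt_le_trans u0 uu).
have vmax0 := ltW (lt_le_trans v0 vv).
apply: divr_ge0; first by rewrite mulr_ge0 // ltW.
do 2 apply: mulr_ge0 (sqr_ge0 _); exact: mulr_ge0.
Qed.

(** Both expectations are exhibited as real numbers, so that the steps can be chained; [0 <= e']
    serves to derive that the rate is nonnegative. *)
Lemma expected_error_step (R : realType) (m p q n : nat)
    (A : 'M[R]_(m, p)) (B : 'M[R]_(q, n)) (C : 'M[R]_(m, n))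
    (A_rows : forall i, row i A != 0) (B_cols : forall j, col j B != 0)
    (consistent : exists X : 'M[R]_(p, q), A *m X *m B = C)
    (prI : {set 'I_m} -> R) (prJ : {set 'I_n} -> R)
    (prI_sampling : sampling prI) (prJ_sampling : sampling prJ)
    (prI_cover : forall i : 'I_m, exists2 S, S \in selectable prI & i \in S)
    (prJ_cover : forall j : 'I_n, exists2 S, S \in selectable prJ & j \in S)
    (d : measure_display) (T : measurableType d) (P : probability T R)
    (I : nat -> T -> {set 'I_m}) (J : nat -> T -> {set 'I_n})
    (I_law : forall k, has_law P (I k) prI)
    (J_law : forall k, has_law P (J k) prJ)
    (IJ_indep : mutually_independent P (selection_events I J))
    (u : nat -> T -> 'I_m -> R) (v : nat -> T -> 'I_n -> R)
    (umin umax vmin vmax : R)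
    (u_nonanticipating : nonanticipating I J u)
    (v_nonanticipating : nonanticipating I J v)
    (umin_gt0 : 0 < umin)
    (vmin_gt0 : 0 < vmin)
    (u_bounds : forall k w i, umin <= u k w i <= umax)
    (v_bounds : forall k w j, vmin <= v k w j <= vmax)
    (eta : R) (eta_bounds : 0 < eta < 2)
    (X0 : 'M[R]_(p, q))
    (X0_range : exists Y : 'M[R]_(m, n), X0 = A^T *m Y *m B^T)
    (k : nat) :
  let Xs := pseudoinverse A *m C *m pseudoinverse B in
  let X w := grabk A B C eta (u ^~ w) (v ^~ w) (I ^~ w) (J ^~ w) X0 in
  let psi := contraction_constant A B prI prJ umin umax vmin vmax in
  let rate := 1 - eta * (2 - eta) * psi
         * sigma_min (row_D A prI) ^+ 2 * sigma_min (col_D B prJ) ^+ 2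
         * sigma_min A ^+ 2 * sigma_min B ^+ 2 in
  0 <= psi ->
  exists e e' : R,
    [/\ 'E_P[(fun w => fnorm (X w k - Xs) ^+ 2)%R]%E = e%:E,
        'E_P[(fun w => fnorm (X w k.+1 - Xs) ^+ 2)%R]%E = e'%:E,
        0 <= e' & e' <= rate * e].
Proof.
move=> Xs X psi rate psi_ge0.
have AXB : A *m Xs *m B = C by exact: pseudoinverse_solution.
have [prI0 prI1] := prI_sampling; have [prJ0 prJ1] := prJ_sampling.
pose H := history I J k; pose Z w := (H w, (I k w, J k w)).
(* Unreached histories get the value [Xs], whose error 0 also has the form required by
   [block_energy_average]. *)
have [Y [XY Ydef]] : exists Y, (forall w, X w k = Y (H w)) /\
    forall h, (exists2 w, H w = h & Y h = X w k) \/ Y h = Xs.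
  by apply: factor_through => w w' /historyP; exact: grabk_nonanticipating.
have [Y' [XY' _]] : exists Y', (forall w, X w k.+1 = Y' (Z w)) /\
    forall z, (exists2 w, Z w = z & Y' z = X w k.+1) \/ Y' z = Xs.
  apply: factor_through => w w' [/historyP h hI hJ].
  apply: grabk_nonanticipating => // l.
  by rewrite ltnS leq_eqVlt => /predU1P [->|/h].
have mZ z : measurable (Z @^-1` [set z]) by exact: (measurable_history_selection I_law J_law).
have mH h : measurable (H @^-1` [set h]) by exact: (measurable_history I_law J_law).
pose mu h := fine (P (H @^-1` [set h])).
have mu0 h : 0 <= mu h by exact: fine_ge0.
have muZ h a b : fine (P (Z @^-1` [set (h, (a, b))])) = mu h * (prI a * prJ b).
  rewrite (history_selection_prob I_law J_law IJ_indep) -EFinM fineM //.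
  exact: fin_num_measure.
pose g h := fnorm (Y h - Xs) ^+ 2.
pose g' z := fnorm (Y' z - Xs) ^+ 2.
exists (\sum_h g h * mu h), (\sum_z g' z * fine (P (Z @^-1` [set z]))); split.
- rewrite -expectation_finite //; last by move=> h; exact: sqr_ge0.
  by congr expectation; apply/funext => w; rewrite /= XY.
- rewrite -expectation_finite //; last by move=> h; exact: sqr_ge0.
  by congr expectation; apply/funext => w; rewrite /= XY'.
- by apply: sumr_ge0 => z _; rewrite mulr_ge0 ?sqr_ge0 // fine_ge0.
have -> : \sum_z g' z * fine (P (Z @^-1` [set z])) =
    \sum_h \sum_a \sum_b g' (h, (a, b)) * (mu h * (prI a * prJ b)).
  under [RHS]eq_bigr do rewrite pair_bigA.
  rewrite pair_bigA; apply: eq_bigr => -[h [a b]] _ /=; by rewrite muZ.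
rewrite mulr_sumr; apply: ler_sum => h _.
pose c := eta * (2 - eta) * psi.
pose S a b := block_energy A B (Y h - Xs) a b.
apply: (@le_trans _ _ (\sum_a \sum_b (g h - c * S a b) * (mu h * (prI a * prJ b)))).
  apply: ler_sum => a _; apply: ler_sum => b _.
  (* Null triples contribute 0 to both sides; any other triple is attained at some [w], where the
     one-step bound holds. *)
  have [->|pN0] := eqVneq (mu h * (prI a * prJ b)) 0; first by rewrite !mulr0.
  rewrite ler_wpM2r ?mulr_ge0 //.
  have [Z0|/set0P [w /= Zw]] := eqVneq (Z @^-1` [set (h, (a, b))]) set0.
    by move: pN0; rewrite -muZ Z0 measure0 eqxx.
  move: pN0; rewrite !mulf_eq0 !negb_or => /and3P [_ pa pb].
  rewrite /g' /g /S -Zw -XY'; case: Zw pa pb => <- <- <- pa pb.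
  rewrite -XY /c {1}/X /=.
  by apply: grabk_step_le => //; rewrite inE lt_def ?pa ?pb ?prI0 ?prJ0.
have -> : \sum_a \sum_b (g h - c * S a b) * (mu h * (prI a * prJ b)) =
    mu h * (g h - c * \sum_a \sum_b prI a * prJ b * S a b).
  rewrite mulrBr.
  have -> : mu h * g h = \sum_a \sum_b g h * (mu h * (prI a * prJ b)).
    under eq_bigr do rewrite -!mulr_sumr prJ1 mulr1.
    by rewrite -!mulr_sumr prI1 mulr1 mulrC.
  rewrite !mulr_sumr -sumrB; apply: eq_bigr => a _.
  rewrite !mulr_sumr -sumrB; apply: eq_bigr => b _; ring.
rewrite mulrC mulrA ler_wpM2r //.
have [E YE] : exists E : 'M[R]_(m, n), Y h - Xs = A^T *m E *m B^T.
  have [[w _ ->]|->] := Ydef h; first exact: grabk_error_range.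
  by exists 0; rewrite subrr mulmx0 mul0mx.
have := block_energy_average A_rows B_cols prI0 prJ0 prI_cover prJ_cover YE.
have c0 : 0 <= c.
  by case/andP: eta_bounds => e0 e2; rewrite mulr_ge0 // mulr_ge0 ?subr_ge0 // ltW.
rewrite -/(g h) => /(ler_wpM2l c0) hc.
rewrite /rate -/c. lra.
Qed.

Theorem theorem3p5 (R : realType) (m p q n : nat)
  (A : 'M[R]_(m, p)) (B : 'M[R]_(q, n)) (C : 'M[R]_(m, n))
  (A_rows : forall i, row i A != 0) (B_cols : forall j, col j B != 0)
  (consistent : exists X : 'M[R]_(p, q), A *m X *m B = C)
  (prI : {set 'I_m} -> R) (prJ : {set 'I_n} -> R)
  (prI_sampling : sampling prI) (prJ_sampling : sampling prJ)
  (prI_cover : forall i : 'I_m, exists2 S, S \in selectable prI & i \in S)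
  (prJ_cover : forall j : 'I_n, exists2 S, S \in selectable prJ & j \in S)
  (d : measure_display) (T : measurableType d) (P : probability T R)
  (I : nat -> T -> {set 'I_m}) (J : nat -> T -> {set 'I_n})
  (I_law : forall k, has_law P (I k) prI)
  (J_law : forall k, has_law P (J k) prJ)
  (IJ_indep : mutually_independent P (selection_events I J))
  (u : nat -> T -> 'I_m -> R) (v : nat -> T -> 'I_n -> R)
  (umin umax vmin vmax : R)
  (u_nonanticipating : nonanticipating I J u)
  (v_nonanticipating : nonanticipating I J v)
  (u_sum : forall k w, I k w \in selectable prI ->
     \sum_(i in I k w) u k w i = 1)
  (v_sum : forall k w, J k w \in selectable prJ ->
     \sum_(j in J k w) v k w j = 1)
  (umin_gt0 : 0 < umin) (umax_lt1 : umax < 1)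
  (vmin_gt0 : 0 < vmin) (vmax_lt1 : vmax < 1)
  (u_bounds : forall k w i, umin <= u k w i <= umax)
  (v_bounds : forall k w j, vmin <= v k w j <= vmax)
  (eta : R) (eta_bounds : 0 < eta < 2)
  (X0 : 'M[R]_(p, q))
  (X0_range : exists Y : 'M[R]_(m, n), X0 = A^T *m Y *m B^T)
  (k : nat) :
  let Xs := pseudoinverse A *m C *m pseudoinverse B in
  let X w := grabk A B C eta (u ^~ w) (v ^~ w) (I ^~ w) (J ^~ w) X0 in
  let psi := (umin * vmin) /
    (umax * vmax * row_gamma_max A prI ^+ 2 * col_gamma_max B prJ ^+ 2) in
  ('E_P[(fun w => fnorm (X w k - Xs) ^+ 2)%R] <=
   ((1 - eta * (2 - eta) * psi
         * sigma_min (row_D A prI) ^+ 2 * sigma_min (col_D B prJ) ^+ 2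
         * sigma_min A ^+ 2 * sigma_min B ^+ 2) ^+ k
    * fnorm (X0 - Xs) ^+ 2)%:E)%E.
Proof.
cbv zeta; set Xs := _ *m C *m _; set psi := _ * _ / _; set rate := 1 - _.
pose X w := grabk A B C eta (u ^~ w) (v ^~ w) (I ^~ w) (J ^~ w) X0.
have AXB : A *m Xs *m B = C by exact: pseudoinverse_solution.
(* A solution is a fixed point. Apart from this case the initial error is positive, which the sign
   of the rate relies on below. *)
have [XX|X0Xs] := eqVneq X0 Xs.
  rewrite XX subrr fnorm0 expr0n mulr0.
  rewrite (_ : (fun w => _) = cst 0) ?expectation_cst //.
  by apply/funext => w /=; rewrite grabk_solution // subrr fnorm0 expr0n.
have e0_gt0 : 0 < fnorm (X0 - Xs) ^+ 2 by rewrite fnorm_sqr_gt0 // subr_eq0.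
have expect0 : 'E_P[(fun w => fnorm (X w 0%N - Xs) ^+ 2)%R]%E =
    (fnorm (X0 - Xs) ^+ 2)%:E by rewrite -[RHS](expectation_cst P).
have [w _] : exists w : T, setT w.
  apply/set0P/eqP => T0; have := @probability_setT _ _ _ P.
  by rewrite T0 measure0 => /eqP; rewrite eqe eq_sym oner_eq0.
have [Y XY] := @grabk_error_range _ _ _ _ _ A B C eta (u ^~ w) (v ^~ w)
  (I ^~ w) (J ^~ w) _ 0%N X0_range.
rewrite /= -/Xs in XY.
(* With no rows or no columns the initial error would be an empty sum. Having an index of each kind
   gives [umin <= umax] and [vmin <= vmax], hence [0 <= psi]. *)
have [i _|noi] := pickP 'I_m; last first.
  move: X0Xs; rewrite -subr_eq0 XY -mulmxA => /eqP[]; apply/matrixP => a b.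
  by rewrite !mxE big1 // => i; have := noi i.
have [j _|noj] := pickP 'I_n; last first.
  move: X0Xs; rewrite -subr_eq0 XY => /eqP[]; apply/matrixP => a b.
  by rewrite !mxE big1 // => j; have := noj j.
have /andP[ui ui'] := u_bounds 0%N w i; have /andP[vj vj'] := v_bounds 0%N w j.
have psi_ge0 : 0 <= psi.
  by apply: contraction_constant_ge0 => //; [exact: le_trans ui'|exact: le_trans vj'].
have step l := @expected_error_step _ _ _ _ _ A B C A_rows B_cols consistent
  prI prJ prI_sampling prJ_sampling prI_cover prJ_cover _ _ P I J I_law J_law
  IJ_indep u v umin umax vmin vmax u_nonanticipating v_nonanticipating umin_gt0
  vmin_gt0 u_bounds v_bounds eta eta_bounds X0 X0_range l psi_ge0.
(* The first step bounds a nonnegative expectation by [rate] times a positive error; the induction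
   needs this sign to multiply by [rate]. *)
have rate_ge0 : 0 <= rate.
  have [e [e' [eE _ e'0 ee']]] := step 0%N.
  move: eE; rewrite expect0 => -[eE].
  by rewrite -(pmulr_lge0 _ e0_gt0) eE; apply: le_trans ee'.
suff [e eE er] : exists2 e : R, 'E_P[(fun w => fnorm (X w k - Xs) ^+ 2)%R]%E = e%:E &
    e <= rate ^+ k * fnorm (X0 - Xs) ^+ 2 by rewrite eE lee_fin.
elim: k => [|l [e eE er]]; first by exists (fnorm (X0 - Xs) ^+ 2); rewrite ?expr0 ?mul1r.
have [e1 [e' [e1E e'E _ ee']]] := step l.
exists e'; first exact: e'E.
move: e1E; rewrite eE => -[e1E]; apply: le_trans ee' _.
by rewrite -e1E (exprS rate) -[leRHS]mulrA ler_wpM2l.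
Qed.
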